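(* Let $\mathcal{H}$ be a countably generated Hilbert $\mathcal{A}$-module over a unital $C^*$-algebra $\mathcal{A}$. Let $\{f_k\}_{k=1}^{\infty}$ be a Bessel sequence in $\mathcal{H}$ with bound $\eta$, and let $S:\mathcal{H}\to\mathcal{H}$, $Sf=\sum_{k=1}^{\infty}\langle f,f_k\rangle f_k$. Suppose that $S=\mathcal{T}+\xi I$ for some real number $\xi$ and some linear operator $\mathcal{T}:\mathcal{H}\to\mathcal{H}$. Then: (1) If $\mathcal{T}$ is a positive operator and $\xi>0$, then $\{f_k\}_{k=1}^{\infty}$ is a frame for $\mathcal{H}$. (2) $\mathcal{T}$ is bounded and self-adjoint. (3) Let $A>0$. If $\{f_k\}_{k=1}^{\infty}$ is a frame with lower bound $A$, then $\mathcal{T}$ is positive whenever $\xi\le A$.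
   Context: Hilbert $\mathcal{A}$-modules are left modules with an $\mathcal{A}$-valued inner product $\langle\cdot,\cdot\rangle$ that is $\mathcal{A}$-linear in the first variable and satisfies $\langle x,y\rangle=\langle y,x\rangle^*$; the norm is $\|x\|=\|\langle x,x\rangle\|^{1/2}$. Inequalities between elements of $\mathcal{A}$ are in the order of self-adjoint elements of $\mathcal{A}$, and series are understood to converge in norm. A sequence $\{f_k\}_{k=1}^\infty$ in $\mathcal{H}$ is a Bessel sequence with bound $B>0$ if $\sum_{k}\langle f,f_k\rangle\langle f_k,f\rangle\le B\langle f,f\rangle$ for all $f\in\mathcal{H}$. It is a frame with lower bound $A>0$ and upper bound $B>0$ if $A\langle f,f\rangle\le\sum_{k}\langle f,f_k\rangle\langle f_k,f\rangle\le B\langle f,f\rangle$ for all $f\in\mathcal{H}$. The operator $\mathcal{T}$ is self-adjoint if it is adjointable with $\mathcal{T}^*=\mathcal{T}$, and positive if $\langle\mathcal{T}f,f\rangle\ge0$ in $\mathcal{A}$ for all $f\in\mathcal{H}$. $I$ is the identity operator on $\mathcal{H}$. *)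

(* Defs.v *)
(* The complex numbers are R[i] for R : realType. *)
From HB Require Import structures.
From mathcomp Require Import all_boot all_order all_algebra.
From mathcomp Require Import complex.
From mathcomp Require Import all_classical all_reals all_analysis.

Set Implicit Arguments.
Unset Strict Implicit.
Unset Printing Implicit Defensive.

Import Order.TTheory GRing.Theory Num.Theory.
Import numFieldNormedType.Exports.

Local Open Scope classical_set_scope.
Local Open Scope complex_scope.
Local Open Scope ring_scope.

(* The norm is R[i]-valued, as for every normedModType R[i]; its values are
   nonnegative reals.  HB has no common ancestor for rings and normed modules
   below numDomainType, so the product is part of the mixin and the ring
   structure is declared afterwards.  It is a pzRingType: 1 = 0 is allowed. *)
HB.mixin Record isUnitalCStarAlgebra (R : realType) A
    of CompleteNormedModule R[i] A := {
  cstar_one : A;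
  cstar_mul : A -> A -> A;
  cstar_mulA : associative cstar_mul;
  cstar_mul1l : left_id cstar_one cstar_mul;
  cstar_mul1r : right_id cstar_one cstar_mul;
  cstar_mulDl : left_distributive cstar_mul +%R;
  cstar_mulDr : right_distributive cstar_mul +%R;
  cstar_scaleAl : forall (c : R[i]) (x y : A),
    c *: cstar_mul x y = cstar_mul (c *: x) y;
  cstar_scaleAr : forall (c : R[i]) (x y : A),
    c *: cstar_mul x y = cstar_mul x (c *: y);
  cstar_normM : forall x y : A, `|cstar_mul x y| <= `|x| * `|y|;
  star : A -> A;
  starK : involutive star;
  starD : {morph star : x y / x + y};
  starZ : forall (c : R[i]) (x : A), star (c *: x) = Num.conj c *: star x;
  starM : forall x y : A, star (cstar_mul x y) = cstar_mul (star y) (star x);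
  cstar_identity : forall x : A, `|cstar_mul (star x) x| = `|x| ^+ 2 }.

#[short(type="unitalCStarAlgType")]
HB.structure Definition UnitalCStarAlgebra (R : realType) :=
  {A of CompleteNormedModule R[i] A & isUnitalCStarAlgebra R A}.

HB.instance Definition _ (R : realType) (A : unitalCStarAlgType R) :=
  GRing.Zmodule_isPzRing.Build A (@cstar_mulA R A) (@cstar_mul1l R A)
    (@cstar_mul1r R A) (@cstar_mulDl R A) (@cstar_mulDr R A).

Section CStarOrder.
Context {R : realType} {A : unitalCStarAlgType R}.
Implicit Types a b : A.

Definition cstar_selfadjoint a : Prop := star a = a.

Definition cstar_invertible a : Prop := exists b, a * b = 1 /\ b * a = 1.

Definition cstar_spectrum a : set R[i] :=
  [set z | ~ cstar_invertible (z *: (1 : A) - a)].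

(* In R[i], 0 <= z means that z is real and nonnegative. *)
Definition cstar_positive a : Prop :=
  cstar_selfadjoint a /\ (forall z, cstar_spectrum a z -> 0 <= z).

Definition cstar_le a b : Prop :=
  [/\ cstar_selfadjoint a, cstar_selfadjoint b & cstar_positive (b - a)].

End CStarOrder.

(* H carries two compatible module structures: *: is the scalar multiplication
   by R[i] and act is the left action of A. *)
HB.mixin Record isHilbertModule (R : realType) (A : unitalCStarAlgType R) H
    of CompleteNormedModule R[i] H := {
  act : A -> H -> H;
  actDl : forall (a b : A) (x : H), act (a + b) x = act a x + act b x;
  actDr : forall (a : A) (x y : H), act a (x + y) = act a x + act a y;
  actA : forall (a b : A) (x : H), act (a * b) x = act a (act b x);
  act1 : forall x : H, act 1 x = x;
  actZl : forall (c : R[i]) (a : A) (x : H), act (c *: a) x = c *: act a x;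
  actZr : forall (c : R[i]) (a : A) (x : H), act a (c *: x) = c *: act a x;
  inner : H -> H -> A;
  innerDl : forall x y z : H, inner (x + y) z = inner x z + inner y z;
  inner_actl : forall (a : A) (x y : H), inner (act a x) y = a * inner x y;
  inner_star : forall x y : H, inner x y = star (inner y x);
  inner_pos : forall x : H, cstar_le 0 (inner x x);
  inner_norm : forall x : H, `|x| ^+ 2 = `|inner x x| }.

#[short(type="hilbertModType")]
HB.structure Definition HilbertModule (R : realType)
    (A : unitalCStarAlgType R) :=
  {H of CompleteNormedModule R[i] H & isHilbertModule R A H}.

Section Frames.
Context {R : realType} {A : unitalCStarAlgType R} {H : hilbertModType A}.
Implicit Types (fk : nat -> H) (f g : H) (T : H -> H).

Definition countably_generated : Prop :=
  exists x : nat -> H,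
    dense [set y : H | exists (n : nat) (a : nat -> A),
                         y = \sum_(k < n) act (a k) (x k)].

Definition frame_series fk f : nat -> A :=
  series (fun k => inner f (fk k) * inner (fk k) f).

Definition frame_operator fk f : H :=
  limn (series (fun k => act (inner f (fk k)) (fk k))).

Definition bessel_bound fk (B : R) : Prop :=
  0 < B /\
  forall f, cvgn (frame_series fk f) /\
    cstar_le (limn (frame_series fk f)) (B%:C *: inner f f).

Definition frame_bounds fk (a b : R) : Prop :=
  [/\ 0 < a, 0 < b &
   forall f, [/\ cvgn (frame_series fk f),
     cstar_le (a%:C *: inner f f) (limn (frame_series fk f)) &
     cstar_le (limn (frame_series fk f)) (b%:C *: inner f f)]].

Definition is_frame fk : Prop := exists a b : R, frame_bounds fk a b.

Definition frame_lower_bound fk (a : R) : Prop :=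
  exists b : R, frame_bounds fk a b.

Definition bounded_operator T : Prop :=
  exists M : R, forall f, `|T f| <= M%:C * `|f|.

Definition is_adjoint T T' : Prop :=
  forall f g, inner (T f) g = inner f (T' g).

Definition self_adjoint T : Prop := is_adjoint T T.

Definition positive_operator T : Prop :=
  forall f, cstar_le 0 (inner (T f) f).

End Frames.

Arguments countably_generated {R A} H.

(* Main.v *)
(* Everything about T = S - xi I is read off <S f, f> = \sum <f, f_k> <f_k, f>,
   once the series defining S is known to converge.  For a block sum
   h = \sum_(m <= k < n) <f, f_k> f_k one has
   <h, h> <= eta \sum_(m <= k < n) <f, f_k> <f_k, f>, by completing squares and
   applying the Bessel bound to h; hence S f converges, |S| <= eta, and S is
   self-adjoint.

   This uses the order of the C*-algebra, where positivity is a condition on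
   the spectrum.  A self-adjoint a has |a| or -|a| in its spectrum: for
   |a| = 1 an inverse of 1 - a^4 would bound the partial sums of \sum a^(4 j),
   but grouping 2^k of them as a product of k factors 1 + b^2 shows that their
   norm is at least 2^k.  Hence, for self-adjoint a and t >= |a|, a is positive
   iff |t - a| <= t, and so positive elements form a closed convex cone. *)
Require Import Defs.
From mathcomp Require Import all_boot all_order all_algebra.
From mathcomp Require Import complex.
From mathcomp Require Import all_classical all_reals all_analysis.
From mathcomp Require Import ring lra.

Set Implicit Arguments.
Unset Strict Implicit.
Unset Printing Implicit Defensive.

Import Order.TTheory GRing.Theory Num.Theory.
Import numFieldNormedType.Exports.

Local Open Scope classical_set_scope.
Local Open Scope complex_scope.
Local Open Scope ring_scope.

(** * Real-valued norms and convergence *)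

Section RealNorm.
Context {R : realType} {V : normedModType R[i]}.
Implicit Types x y : V.

(** The norm is a nonnegative real inside [R[i]], so its real part determines it and estimates can
    be made in [R]. *)
Definition rnorm x : R := complex.Re `|x|.

Lemma normE x : `|x| = (rnorm x)%:C.
Proof.
have := normr_ge0 x; rewrite lecE => /andP[/eqP /= im0 _].
by rewrite /rnorm; case: `|x| im0 => a b /= ->.
Qed.

Lemma rnorm_ge0 x : 0 <= rnorm x.
Proof. by rewrite -ler0c -normE. Qed.

Lemma ler_rnormD x y : rnorm (x + y) <= rnorm x + rnorm y.
Proof. by rewrite -lecR rmorphD /= -!normE ler_normD. Qed.

Lemma rnormN x : rnorm (- x) = rnorm x.
Proof. by rewrite /rnorm normrN. Qed.

Lemma rnormB x y : rnorm (x - y) = rnorm (y - x).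
Proof. by rewrite /rnorm distrC. Qed.

Lemma ler_rnormB x y : rnorm (x - y) <= rnorm x + rnorm y.
Proof. by rewrite -(rnormN y) ler_rnormD. Qed.

Lemma rnorm0 : rnorm (0 : V) = 0.
Proof. by rewrite /rnorm normr0. Qed.

Lemma rnorm_eq0 x : rnorm x = 0 -> x = 0.
Proof. by move=> x0; apply/eqP; rewrite -normr_eq0 normE x0. Qed.

Lemma rnormZ (c : R[i]) x : rnorm (c *: x) = complex.Re `|c| * rnorm x.
Proof.
rewrite /rnorm normrZ [`|x|]normE.
by case: `|c| => a b; rewrite /= !(mulr0, mul0r, subr0).
Qed.

Lemma rnormZr (r : R) x : rnorm (r%:C *: x) = `|r| * rnorm x.
Proof. by rewrite rnormZ normc_def /= expr0n addr0 sqrtr_sqr. Qed.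

Lemma cvg_rnormP (u : nat -> V) (l : V) :
  u @ \oo --> l <->
  forall e : R, 0 < e -> exists N, forall n, (N <= n)%N -> rnorm (l - u n) < e.
Proof.
split=> [/cvgrPdist_lt ul e e0|ul].
  have /ul[N _ uN] : 0 < e%:C by rewrite ltcR.
  by exists N => n Nn; rewrite -ltcR -normE; exact: uN.
(* A positive [e] of [R[i]] has zero imaginary part, so real tolerances suffice. *)
apply/cvgrPdist_lt => e; rewrite ltcE => /andP[/eqP /= im0 e0].
have [N uN] := ul _ e0; exists N => // n /= Nn.
by rewrite normE ltcE /= im0 eqxx uN.
Qed.

Lemma rnorm_le_cvg (u : nat -> V) (l : V) (M : R) :
  u @ \oo --> l -> (exists N, forall n, (N <= n)%N -> rnorm (u n) <= M) ->
  rnorm l <= M.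
Proof.
move=> /cvg_rnormP ul [N uM]; apply/ler_addgt0Pr => e e0.
have [N' uN] := ul _ e0.
have := ler_rnormD (l - u (maxn N N')) (u (maxn N N')); rewrite subrK.
move/le_trans; apply; rewrite addrC lerD ?uM ?leq_maxl//.
exact/ltW/uN/leq_maxr.
Qed.

End RealNorm.

Lemma cauchy_rnorm (R : realType) (V : completeNormedModType R[i])
    (u : nat -> V) :
  (forall e : R, 0 < e -> exists N, forall n, (N <= n)%N ->
    rnorm (u N - u n) < e) -> cvgn u.
Proof.
move=> cu; apply/cauchy_cvgP/cauchy_exP => e;
  rewrite ltcE => /andP[/eqP /= im0 e0].
have [N uN] := cu _ e0; exists (u N); exists N => // n /= Nn.
by rewrite -ball_normE /ball_ /= normE ltcE /= im0 eqxx uN.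
Qed.

(** * Involution, norm and invertibility in a C*-algebra *)

Section CStarBasics.
Context {R : realType} {A : unitalCStarAlgType R}.
Implicit Types (a b x y : A) (c z : R[i]).

Lemma cscalerAl c x y : c *: (x * y) = (c *: x) * y.
Proof. exact: cstar_scaleAl. Qed.

Lemma cscalerAr c x y : c *: (x * y) = x * (c *: y).
Proof. exact: cstar_scaleAr. Qed.

Lemma star_mul x y : star (x * y) = star y * star x.
Proof. exact: starM. Qed.

Lemma star0 : star (0 : A) = 0.
Proof. by rewrite -[X in star X](scale0r (0 : A)) starZ rmorph0 scale0r. Qed.

Lemma starN x : star (- x) = - star x.
Proof. by rewrite -scaleN1r starZ rmorphN1 scaleN1r. Qed.

Lemma starB x y : star (x - y) = star x - star y.
Proof. by rewrite starD starN. Qed.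

Lemma star1 : star (1 : A) = 1.
Proof. by rewrite -[LHS]mulr1 -[X in _ * X]starK -star_mul mulr1 starK. Qed.

Lemma star_exp x n : star (x ^+ n) = star x ^+ n.
Proof. by elim: n => [|n IH];
  rewrite ?expr0 ?star1// exprS star_mul IH -exprSr. Qed.

Lemma conjC_real_complex (r : R) : Num.conj r%:C = r%:C.
Proof. by apply/eqP; rewrite eq_complex /= oppr0 !eqxx. Qed.

Lemma starZr (r : R) x : star (r%:C *: x) = r%:C *: star x.
Proof. by rewrite starZ conjC_real_complex. Qed.

Lemma star_scale1 z : star (z *: (1 : A)) = Num.conj z *: (1 : A).
Proof. by rewrite starZ star1. Qed.

Lemma starZi x : star ('i *: x) = - ('i *: star x).
Proof. by rewrite starZ conjCi scaleNr. Qed.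

Lemma ler_rnormM x y : rnorm (x * y) <= rnorm x * rnorm y.
Proof. by rewrite -lecR rmorphM /= -!normE; exact: cstar_normM. Qed.

Lemma rnorm_starM x : rnorm (star x * x) = rnorm x ^+ 2.
Proof.
have := cstar_identity x; rewrite !normE -rmorphXn /= => /eqP.
by rewrite eq_complex /= eqxx andbT => /eqP.
Qed.

(** Cancel [|y|] in [|y|^2 = |y^* y| <= |y^*| |y|], for [y = x] and for [y = x^*]. *)
Lemma rnorm_star x : rnorm (star x) = rnorm x.
Proof.
suff le y : rnorm y <= rnorm (star y).
  by apply/le_anti; rewrite le andbT -{2}(starK x) le.
have [->|y0] := eqVneq (rnorm y) 0; first exact: rnorm_ge0.
have yp : 0 < rnorm y by rewrite lt_neqAle eq_sym y0 rnorm_ge0.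
by rewrite -(ler_pM2r yp) -expr2 -rnorm_starM ler_rnormM.
Qed.

Lemma rnorm_Mstar x : rnorm (x * star x) = rnorm x ^+ 2.
Proof. by rewrite -{1}(starK x) rnorm_starM rnorm_star. Qed.

(** The C*-identity gives [|1| = |1|^2], so [|1|] is 0 or 1; it is 0 in the zero algebra. *)
Lemma rnorm1_le : rnorm (1 : A) <= 1.
Proof.
have := rnorm_starM 1; rewrite star1 mulr1 => /esym/eqP.
rewrite -subr_eq0 expr2 -[X in _ - X]mulr1 -mulrBr mulf_eq0 subr_eq0.
by case/orP => /eqP ->.
Qed.

Lemma ler_rnormX x n : rnorm (x ^+ n) <= rnorm x ^+ n.
Proof.
elim: n => [|n IH]; first by rewrite !expr0 rnorm1_le.
by rewrite !exprS (le_trans (ler_rnormM _ _))// ler_wpM2l// rnorm_ge0.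
Qed.

Lemma cvg_mull a (u : nat -> A) (l : A) :
  u @ \oo --> l -> (fun n => a * u n) @ \oo --> a * l.
Proof.
move=> /cvg_rnormP ul; apply/cvg_rnormP => e e0.
have e1 : 0 < e / (rnorm a + 1) by rewrite divr_gt0// ltr_wpDl// rnorm_ge0.
have [N uN] := ul _ e1; exists N => n /uN.
rewrite ltr_pdivlMr ?ltr_wpDl// ?rnorm_ge0// => h.
rewrite -mulrBr (le_lt_trans (ler_rnormM _ _))// mulrC (le_lt_trans _ h)//.
by rewrite ler_wpM2l ?rnorm_ge0// lerDl.
Qed.

Lemma cvg_star (u : nat -> A) (l : A) :
  u @ \oo --> l -> (fun n => star (u n)) @ \oo --> star l.
Proof.
move=> /cvg_rnormP ul; apply/cvg_rnormP => e /ul[N uN].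
by exists N => n /uN; rewrite -starB rnorm_star.
Qed.

Lemma cvg_mulr a (u : nat -> A) (l : A) :
  u @ \oo --> l -> (fun n => u n * a) @ \oo --> l * a.
Proof.
move=> /cvg_star/(@cvg_mull (star a))/cvg_star; rewrite star_mul !starK.
by under eq_fun do rewrite star_mul !starK.
Qed.

Lemma cstar_cvg_unique (u : nat -> A) (l l' : A) :
  u @ \oo --> l -> u @ \oo --> l' -> l = l'.
Proof. by apply: cvg_unique; exact: norm_hausdorff. Qed.

Lemma cstar_invertibleM a b :
  cstar_invertible a -> cstar_invertible b -> cstar_invertible (a * b).
Proof.
move=> [a' [aa' a'a]] [b' [bb' b'b]]; exists (b' * a'); split.
  by rewrite mulrA -(mulrA a) bb' mulr1.
by rewrite mulrA -(mulrA b') a'a mulr1.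
Qed.

Lemma cstar_invertible_lr a b b' :
  a * b = 1 -> b' * a = 1 -> cstar_invertible a.
Proof.
move=> ab ba; exists b; split=> //.
suff <- : b' = b by [].
by rewrite -[b']mulr1 -ab mulrA ba mul1r.
Qed.

(** If [c] inverts [a b = b a], then [b c] and [c b] are a right and a left inverse of [a]. *)
Lemma cstar_invertible_comm a b :
  GRing.comm a b -> cstar_invertible (a * b) -> cstar_invertible a.
Proof.
move=> ab [c [h1 h2]]; apply: (@cstar_invertible_lr _ (b * c) (c * b)).
  by rewrite mulrA.
by rewrite -mulrA -[b * a]ab.
Qed.

Lemma cstar_invertibleZ z a :
  z != 0 -> cstar_invertible a -> cstar_invertible (z *: a).
Proof.
move=> z0 [b [ab ba]]; exists (z^-1 *: b).
by rewrite -!cscalerAr -!cscalerAl !scalerA mulVf// mulfV// ab ba scale1r.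
Qed.

Lemma cstar_invertibleZE z a :
  z != 0 -> cstar_invertible (z *: a) <-> cstar_invertible a.
Proof.
move=> z0; split; last exact: cstar_invertibleZ.
move/(@cstar_invertibleZ z^-1); rewrite scalerA mulVf// scale1r.
by apply; rewrite invr_eq0.
Qed.

Lemma cstar_invertibleN a : cstar_invertible (- a) <-> cstar_invertible a.
Proof. by rewrite -scaleN1r cstar_invertibleZE// oppr_eq0 oner_eq0. Qed.

(** Neumann series: the partial sums [s n] converge, and their products with [1 - x] on either side
    are [1 - x^n], which tends to 1. *)
Lemma cstar_invertible1B x : rnorm x < 1 -> cstar_invertible (1 - x).
Proof.
set r := rnorm x => r1; have r0 : 0 <= r by exact: rnorm_ge0.
have r1' : 0 < 1 - r by rewrite subr_gt0.
pose s n : A := \sum_(k < n) x ^+ k.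
have sE n : (1 - x) * s n = 1 - x ^+ n.
  by rewrite -[RHS]opprB subrX1 -mulNr opprB.
have sE' n : s n * (1 - x) = 1 - x ^+ n.
  by rewrite -sE; apply/esym/commr_sum => k _; apply/commr_sym/commrB;
     [exact: commr1 | exact/commr_sym/commrX].
have s_le n : rnorm (s n) <= (1 - r)^-1.
  suff : rnorm (s n) * (1 - r) <= 1 - r ^+ n.
    by rewrite -ler_pdivlMr// => /le_trans; apply;
      rewrite ler_piMl ?invr_ge0 ?(ltW r1')// gerBl exprn_ge0.
  elim: n => [|n IH]; first by rewrite /s big_ord0 rnorm0 mul0r expr0 subrr.
  rewrite /s big_ord_recr /=.
  have h1 := ler_rnormD (s n) (x ^+ n); have h2 := ler_rnormX x n.
  have h3 : rnorm (s n + x ^+ n) * (1 - r) <= (rnorm (s n) + r ^+ n) * (1 - r).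
    by rewrite ler_pM2r// (le_trans h1)// lerD2l.
  by rewrite (le_trans h3)// mulrDl exprSr; lra.
have expr_cvg (e : R) : 0 < e -> exists N, forall n, (N <= n)%N -> r ^+ n < e.
  move=> e0; have := @cvg_expr R r; rewrite ger0_norm// => /(_ r1).
  move=> /cvgrPdist_lt/(_ _ e0)[N _ rN]; exists N => n /rN.
  by rewrite sub0r normrN ger0_norm// exprn_ge0.
have : cvgn s.
  apply: cauchy_rnorm => e e0.
  have e1 : 0 < e * (1 - r) by rewrite mulr_gt0.
  have [N rN] := expr_cvg _ e1; exists N => n Nn.
  (* The tail is [s n - s N = x^N s (n - N)], of norm at most [r^N / (1 - r)]. *)
  rewrite rnormB /s -(subnKC Nn) big_split_ord /= addrAC subrr add0r.
  under eq_bigr do rewrite exprD.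
  rewrite -mulr_sumr (le_lt_trans (ler_rnormM _ _))//.
  have h1 := rN N (leqnn N); have h2 := ler_rnormX x N;
    have h3 := s_le (n - N)%N.
  rewrite (@le_lt_trans _ _ (r ^+ N * (1 - r)^-1))//;
    last by rewrite ltr_pdivrMr.
  by rewrite ler_pM// ?rnorm_ge0.
move=> cs; have sl : s @ \oo --> limn s by [].
have lim1 : (fun n => 1 - x ^+ n) @ \oo --> (1 : A).
  apply/cvg_rnormP => e /expr_cvg[N rN]; exists N => n /rN h.
  by rewrite opprB addrC subrK (le_lt_trans (ler_rnormX _ _)).
exists (limn s); split.
  apply: (@cstar_cvg_unique (fun n => (1 - x) * s n)); first exact: cvg_mull.
  by under eq_fun do rewrite sE.
apply: (@cstar_cvg_unique (fun n => s n * (1 - x))); first exact: cvg_mulr.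
by under eq_fun do rewrite sE'.
Qed.

(** Factor [z - x = z (1 - z^-1 x)]. *)
Lemma cstar_resolvent_norm z x :
  rnorm x < complex.Re `|z| -> cstar_invertible (z *: (1 : A) - x).
Proof.
move=> xz; have zp : 0 < complex.Re `|z| := le_lt_trans (rnorm_ge0 x) xz.
have z0 : z != 0 by apply: contraTneq zp => ->; rewrite normr0 /= ltxx.
rewrite -(cstar_invertibleZE _ (z := z^-1)) ?invr_eq0//.
rewrite scalerBr scalerA mulVf// scale1r; apply: cstar_invertible1B.
rewrite rnormZ normfV.
have -> : `|z|^-1 = (complex.Re `|z|)^-1%:C.
  by rewrite fmorphV normc_def.
by rewrite [X in X < _]mulrC ltr_pdivrMr// mul1r.
Qed.

Lemma cstar_spectrum_norm x z : cstar_spectrum x z -> complex.Re `|z| <= rnorm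
  x.
Proof. by move=> sz; rewrite leNgt; apply/negP => /cstar_resolvent_norm. Qed.

Lemma mul_shifts z c a :
  (z *: (1 : A) + a) * (c *: (1 : A) + a) = (z * c) *: (1 : A) + (z + c) *: a +
    a * a.
Proof.
rewrite mulrDl !mulrDr -!cscalerAl -!cscalerAr !mul1r !mulr1 scalerA scalerDl.
by rewrite !addrA.
Qed.

End CStarBasics.

(** * Imaginary shifts and the real spectrum of self-adjoint elements *)

Section RealSpectrum.
Context {R : realType} {A : unitalCStarAlgType R}.
Implicit Types (a b x y : A) (z : R[i]).

Lemma star_real_shift (t : R) a : star a = a ->
  star (t%:C *: (1 : A) + a) = t%:C *: (1 : A) + a.
Proof. by move=> sa; rewrite starD star_scale1 conjC_real_complex sa. Qed.

Lemma star_imag_shift (t : R) a : star a = a ->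
  star (('i * t%:C) *: (1 : A) + a) = (- ('i * t%:C)) *: (1 : A) + a.
Proof.
by move=> sa;
  rewrite starD star_scale1 rmorphM /= conjCi conjC_real_complex mulNr sa.
Qed.

Lemma mul_imag_shifts (t : R) a :
  ((- ('i * t%:C)) *: (1 : A) + a) * (('i * t%:C) *: (1 : A) + a) =
  (t ^+ 2)%:C *: (1 : A) + a * a.
Proof.
rewrite mul_shifts addNr scale0r addr0; congr (_ *: _ + _).
by rewrite mulNr mulrACA -[X in X * _]expr2 sqrCi mulN1r opprK -expr2 rmorphXn.
Qed.

Lemma rnorm_imag_shift (t : R) a : star a = a ->
  rnorm (('i * t%:C) *: (1 : A) + a) ^+ 2 = rnorm ((t ^+ 2)%:C *: (1 : A) + a *
    a).
Proof. by move=> sa;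
  rewrite -rnorm_starM star_imag_shift// mul_imag_shifts. Qed.

(** With [t = |a|^2], write [i - a = i (1 + t) - (i t + a)]. Since [|i t + a|^2 = |t^2 + a^2| <= t^2
    + t < (1 + t)^2], the resolvent bound applies. *)
Lemma cstar_invertible_iB a : star a = a -> cstar_invertible ('i *: (1 : A) -
  a).
Proof.
move=> sa; set t := rnorm a ^+ 2.
have t0 : 0 <= t by exact: sqr_ge0.
have -> : 'i *: (1 : A) - a = ('i * (1 + t)%:C) *: (1 : A) - (('i * t%:C) *: (1
  : A) + a).
  by rewrite opprD addrA -scalerBl -mulrBr -rmorphB /= addrK rmorph1 mulr1.
apply: cstar_resolvent_norm.
have -> : complex.Re `|'i * (1 + t)%:C : R[i]| = 1 + t.
  by rewrite normrM normCi mul1r normc_def /= expr0n addr0 sqrtr_sqr ger0_norm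
    ?addr_ge0.
rewrite -(@ltr_pXn2r _ 2) ?nnegrE ?rnorm_ge0 ?addr_ge0// rnorm_imag_shift//.
rewrite (le_lt_trans (ler_rnormD _ _))// rnormZr ger0_norm ?sqr_ge0//.
have h1 := ler_rnormM a a; rewrite -expr2 -/t in h1.
have h2 : t ^+ 2 * rnorm (1 : A) <= t ^+ 2 by rewrite ler_piMr ?sqr_ge0
  ?rnorm1_le.
have -> : (1 + t) ^+ 2 = t ^+ 2 + t + (1 + t) by ring.
by rewrite (le_lt_trans (lerD h2 h1))// ltrDl ltr_pwDl.
Qed.

(** For [z = u + i v] with [v != 0], [z - a = v (i - v^-1 (a - u))] and [v^-1 (a - u)] is
    self-adjoint. *)
Lemma cstar_spectrum_selfadjoint a z :
  star a = a -> cstar_spectrum a z -> z = (complex.Re z)%:C.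
Proof.
move=> sa; have [v0 _|v0 sz] := eqVneq (complex.Im z) 0.
  by case: z v0 => u v /= ->.
case: sz; set u := complex.Re z; set v := complex.Im z in v0 *.
have -> : z *: (1 : A) - a =
    v%:C *: ('i *: (1 : A) - v^-1%:C *: ((- u)%:C *: (1 : A) + a)).
  have vv : v%:C * v^-1%:C = 1 by rewrite -rmorphM /= mulfV.
  rewrite scalerBr !scalerA vv scale1r opprD addrA; congr (_ - _).
  rewrite -scaleNr -rmorphN /= opprK -scalerDl; congr (_ *: _).
  by rewrite [LHS]complexE complexiE addrC mulrC.
apply: cstar_invertibleZ; first by rewrite fmorph_eq0.
by apply: cstar_invertible_iB; rewrite starZr star_real_shift.
Qed.

(* [x x^* (1 + b^2)] is the square of the modulus of both [X = x (i + b)] and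
   [Y = x^* (i + b)], while [x x^* b] is half the imaginary part of [X Y]. *)
Lemma rnorm_modulus_AGM x b : star b = b ->
  GRing.comm x (star x) -> GRing.comm x b -> GRing.comm (star x) b ->
  2 * rnorm (x * star x * b) <= rnorm (x * star x * (1 + b * b)).
Proof.
move=> sb xx xb x'b.
set q := x * star x; set w := ('i * (1 : R)%:C) *: (1 : A) + b.
have sw : star w = (- ('i * (1 : R)%:C)) *: (1 : A) + b by exact:
  star_imag_shift.
have ww : w * star w = 1 + b * b.
  rewrite sw /w mul_shifts subrr scale0r addr0 mulrN -mulNr.
  by rewrite mulNr rmorph1 mulr1 -expr2 sqrCi opprK scale1r.
have qb : GRing.comm q b by apply/commr_sym/commrM; exact: commr_sym.
have Xn : rnorm (x * w) ^+ 2 = rnorm (q * (1 + b * b)).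
  rewrite -rnorm_Mstar star_mul -mulrA (mulrA w) ww; congr rnorm.
  rewrite /q -[RHS]mulrA; congr (_ * _); apply/commr_sym/commrD;
    first exact: commr1.
  exact: commrM.
have Yn : rnorm (star x * w) ^+ 2 = rnorm (q * (1 + b * b)).
  rewrite -rnorm_Mstar star_mul starK -mulrA (mulrA w) ww; congr rnorm.
  rewrite /q [x * star x]xx -[RHS]mulrA; congr (_ * _); apply/commr_sym/commrD;
    first exact: commr1.
  exact: commrM.
have XYn : rnorm (x * w * (star x * w)) <= rnorm (q * (1 + b * b)).
  rewrite (le_trans (ler_rnormM _ _))//.
  have -> : rnorm (star x * w) = rnorm (x * w).
    by apply/eqP; rewrite -(@eqrXn2 _ 2) ?rnorm_ge0// Xn Yn.
  by rewrite -expr2 Xn.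
have x'w : GRing.comm (star x) w.
  apply: commrD => //; rewrite /GRing.comm -cscalerAr -cscalerAl mul1r mulr1.
  by [].
have qw : GRing.comm q w.
  apply: commrD => //; rewrite /GRing.comm -cscalerAr -cscalerAl mul1r mulr1.
  by [].
have qsw : GRing.comm q (star w).
  rewrite sw; apply: commrD => //.
  by rewrite /GRing.comm -cscalerAr -cscalerAl mul1r mulr1.
have XYE : x * w * (star x * w) = q * (w * w).
  by rewrite -[LHS]mulrA (mulrA w) -x'w !mulrA.
have XYE' : star (x * w * (star x * w)) = q * (star w * star w).
  rewrite XYE star_mul [star (w * w)]star_mul [star q]star_mul starK.
  by apply/commr_sym/commrM.
(* The squares of [i + b] and [b - i] differ by [4 i b]. *)
have XYim : x * w * (star x * w) - star (x * w * (star x * w)) = (4 * 'i) *: (q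
  * b).
  rewrite XYE' XYE -mulrBr cscalerAr sw /w !mul_shifts.
  congr (q * _);
    rewrite mulrNN opprD addrACA subrr addr0 opprD addrACA subrr add0r.
  rewrite -scalerBl rmorph1 mulr1; congr (_ *: _).
  by ring.
have : rnorm ((4 * 'i : R[i]) *: (q * b)) <= 2 * rnorm (q * (1 + b * b)).
  rewrite -XYim (le_trans (ler_rnormB _ _))// rnorm_star.
  by rewrite mulr_natl mulr2n lerD.
rewrite rnormZ normrM normCi mulr1 normr_nat.
have -> : complex.Re (4 : R[i]) = 4.
  by rewrite -[4 in LHS](rmorph_nat (@real_complex R)).
by lra.
Qed.

End RealSpectrum.

(** * The norm of a self-adjoint element as a spectral value *)

Section SpectralRadius.
Context {R : realType} {A : unitalCStarAlgType R}.
Implicit Types (a b x y : A) (z : R[i]).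

(** The C*-identity settles the exponents [2^k]; in general [1 = |a^(2^n)| <= |a^(2^n - n)| |a^n| <=
    |a^n|]. *)
Lemma rnorm_selfadjointX a n : star a = a -> rnorm a = 1 -> rnorm (a ^+ n) = 1.
Proof.
move=> sa a1.
have pow2 k : rnorm (a ^+ (2 ^ k)) = 1.
  elim: k => [|k IH]; first by rewrite expn0 expr1.
  rewrite expnS mulnC exprM expr2 -[X in X * _](_ : star (a ^+ (2 ^ k)) = _).
    by rewrite rnorm_starM IH expr1n.
  by rewrite star_exp sa.
apply/le_anti/andP; split;
  first by rewrite (le_trans (ler_rnormX _ _))// a1 expr1n.
have <- := pow2 n; rewrite -{1}(subnK (ltnW (ltn_expl n (ltnSn 1)))) exprD.
rewrite (le_trans (ler_rnormM _ _))// ler_piMl ?rnorm_ge0//.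
by rewrite (le_trans (ler_rnormX _ _))// a1 expr1n.
Qed.

Lemma star_comm x y : GRing.comm x (star y) -> GRing.comm (star x) y.
Proof. by move=> xy; rewrite /GRing.comm -{1 2}(starK y) -!star_mul xy. Qed.

(* The witness is [x = \prod_(j < k) (1 + i a^(2 2^j))]: then [x x^*] is both
   [\sum_(j < 2^k) a^(4 j)] and a product of factors [1 + b^2], each of which
   at least doubles the norm by [rnorm_modulus_AGM]. *)
Lemma geometric_modulus a k : star a = a -> rnorm a = 1 -> exists x : A,
  [/\ forall y, GRing.comm a y -> GRing.comm x y,
      x * star x * (1 - a ^+ 4) = 1 - a ^+ (4 * 2 ^ k) &
      forall m, 2 ^+ k <= rnorm (x * star x * a ^+ (2 * m))].
Proof.
move=> sa a1; elim: k => [|k [x [xa xgeo xge]]].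
  exists 1; split=> [y _||m]; first exact: commr_sym (commr1 y).
    by rewrite star1 !mul1r.
  by rewrite star1 !mul1r rnorm_selfadjointX.
set b := a ^+ (2 * 2 ^ k).
have sb : star b = b by rewrite star_exp sa.
have acomm n : GRing.comm a (a ^+ n) by exact: commrX.
have ax' y : GRing.comm a y -> GRing.comm (star x) y.
  move=> ay; apply/star_comm/xa; rewrite /GRing.comm -{1 2}sa -!star_mul.
  by rewrite ay.
have ax : GRing.comm a x by apply/commr_sym/xa.
have bb : b * b = a ^+ (4 * 2 ^ k) by rewrite -exprD -mulnDl.
set w := 1 + 'i *: b.
have sw : star w = 1 - 'i *: b by rewrite starD star1 starZi sb.
have ww : w * star w = 1 + b * b.
  rewrite sw /w mulrBr mulr1 mulrDl mul1r -cscalerAl -cscalerAr scalerA.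
  by rewrite -expr2 sqrCi scaleN1r opprD opprK addrA addrK.
have wx : GRing.comm w (star x).
  apply/commr_sym/commrD; first exact: commr1.
  by rewrite /GRing.comm -cscalerAr -cscalerAl ax'//; exact: acomm.
have qE : x * w * star (x * w) = x * star x * (1 + b * b).
  rewrite star_mul -mulrA (mulrA w) ww -[RHS]mulrA; congr (_ * _).
  apply/commr_sym/commrD; first exact: commr1.
  by apply: commrM; apply: ax'; exact: acomm.
exists (x * w); split=> [y ay||m].
- apply/commr_sym/commrM; first exact/commr_sym/xa.
  apply/commrD; first exact: commr1.
  rewrite /GRing.comm -cscalerAr -cscalerAl; congr (_ *: _).
  by apply/commr_sym; apply: commr_sym; exact/commrX/commr_sym.
- rewrite qE -mulrA [(1 + _) * _](_ : _ = (1 - a ^+ 4) * (1 + b * b)).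
    rewrite mulrA xgeo bb mulrBl mul1r mulrDr mulr1 -exprD -mulnDr addnn -mul2n.
    by rewrite -expnS opprD addrA addrK.
  apply/commr_sym/commrD; first exact: commr1.
  apply/commr_sym/commrB; first exact: commr1.
  by rewrite bb; apply/commrX/commr_sym/acomm.
have sam : star (a ^+ m) = a ^+ m by rewrite star_exp sa.
(* The doubling is applied to [X], as [X X^* = x x^* a^(2 m)]. Multiplication by [b] moves the
   exponent to [2 (m + 2^k)], which is why the induction ranges over all [m]. *)
set X := x * a ^+ m.
have sX : star X = star x * a ^+ m by rewrite star_mul sam ax'.
have XX : X * star X = x * star x * a ^+ (2 * m).
  rewrite sX mul2n -addnn exprD !mulrA; congr (_ * _).
  by rewrite -!mulrA [star x * _]ax'.
have Xb : GRing.comm X b by apply/commr_sym/commrM;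
  [exact/commr_sym/xa/acomm | exact/commrX/commr_sym/commrX/commr_refl].
have X'b : GRing.comm (star X) b by apply: star_comm; rewrite sb.
have XXc : GRing.comm X (star X).
  rewrite sX; apply: commrM; apply/commr_sym/commrM.
  - exact: ax'.
  - exact: ax'.
  - exact/commr_sym/xa.
  - exact: commr_refl.
have := rnorm_modulus_AGM sb XXc Xb X'b.
rewrite XX qE -!mulrA -[a ^+ (2 * m) * b]exprD -mulnDr !mulrA.
have -> : x * star x * a ^+ (2 * m) * (1 + b * b) = x * star x * (1 + b * b) *
  a ^+ (2 * m).
  rewrite -!mulrA; do 2![congr (_ * _)]; apply/commrD; first exact: commr1.
  by rewrite bb; exact/commrX/commr_sym/commrX/commr_refl.
by apply: le_trans; rewrite exprS ler_pM2l ?ltr0n.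
Qed.

(** If [c] inverts [1 - a^4], the witness of [geometric_modulus] has [x x^* = (1 - a^(4 2^k)) c], so
    [2^k <= 2 |c|] for every [k]. *)
Lemma not_invertible_1B4 a : star a = a -> rnorm a = 1 ->
  ~ cstar_invertible (1 - a ^+ 4).
Proof.
move=> sa a1 [c [ac _]].
have le k : 2 ^+ k <= 2 * rnorm c.
  have [x [_ xgeo /(_ 0%N)]] := geometric_modulus k sa a1.
  rewrite muln0 expr0 mulr1 => /le_trans; apply.
  rewrite -[X in rnorm X]mulr1 -ac mulrA xgeo (le_trans (ler_rnormM _ _))//.
  rewrite ler_wpM2r ?rnorm_ge0// (le_trans (ler_rnormB _ _))//.
  by rewrite rnorm_selfadjointX// lerD// rnorm1_le.
have c0 : 0 <= 2 * rnorm c by rewrite mulr_ge0 ?rnorm_ge0.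
have := le (Num.bound (2 * rnorm c)); rewrite leNgt => /negP; apply.
rewrite (lt_le_trans (archi_boundP c0))// -natrX ler_nat ltnW//.
exact: ltn_expl.
Qed.

(** Otherwise, for [b = a / |a|], the factors of [1 - b^4 = (1 - b) (1 + b) (1 + b^2)] are all
    invertible, the last one as [(b - i) (b + i)]. *)
Lemma cstar_spectrum_rnorm a : star a = a -> a <> 0 ->
  cstar_spectrum a (rnorm a)%:C \/ cstar_spectrum a (- rnorm a)%:C.
Proof.
move=> sa a0; set s := rnorm a.
have s0 : s != 0 by apply/eqP => /rnorm_eq0.
apply: contrapT => /not_orP[/contrapT i1 /contrapT i2].
pose b := s^-1%:C *: a.
have sb : star b = b by rewrite starZr sa.
have b1 : rnorm b = 1.
  by rewrite rnormZr ger0_norm ?invr_ge0 ?rnorm_ge0// mulVf.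
have Vs : s^-1%:C * s%:C = 1 by rewrite -rmorphM /= mulVf.
have Vs0 : s^-1%:C != 0 :> R[i] by rewrite fmorph_eq0 invr_eq0.
have j1 : cstar_invertible (1 - b).
  by have := cstar_invertibleZ Vs0 i1; rewrite scalerBr scalerA Vs scale1r.
have j2 : cstar_invertible (1 + b).
  have := cstar_invertibleZ Vs0 i2.
  rewrite scalerBr scalerA rmorphN mulrN Vs scaleN1r -opprD => h.
  exact/cstar_invertibleN.
have j3 : cstar_invertible (1 + b * b).
  have := mul_imag_shifts 1 b; rewrite expr1n rmorph1 mulr1 scale1r => <-.
  apply: cstar_invertibleM.
    rewrite scaleNr addrC -opprB; apply/cstar_invertibleN.
    exact: cstar_invertible_iB.
  by have := @cstar_invertible_iB _ _ (- b); rewrite opprK; apply;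
    rewrite starN sb.
apply: (not_invertible_1B4 sb b1).
have -> : 1 - b ^+ 4 = (1 - b) * (1 + b) * (1 + b * b).
  have e x : (1 - x) * (1 + x) = 1 - x * x.
    by rewrite mulrBl mul1r mulrDr mulr1 opprD addrA addrK.
  by rewrite e e !exprS expr0 mulr1 !mulrA.
by do 2?apply: cstar_invertibleM.
Qed.

End SpectralRadius.

(** * The closed convex cone of positive elements *)

Section PositiveCone.
Context {R : realType} {A : unitalCStarAlgType R}.
Implicit Types (a b x y : A) (z c : R[i]) (s t : R).

Lemma cstar_spectrum_shift c z a :
  cstar_spectrum (c *: (1 : A) - a) z <-> cstar_spectrum a (c - z).
Proof.
rewrite /cstar_spectrum /= -cstar_invertibleN.
by rewrite opprB addrAC scalerBl.
Qed.

(** If [b = t - a] had [|b| > t], the spectrum of [a] would contain [t - |b| < 0], against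
    positivity, or [t + |b| > |a|], against the norm bound. *)
Lemma rnorm_shift_positive a t : cstar_positive a -> rnorm a <= t ->
  rnorm (t%:C *: (1 : A) - a) <= t.
Proof.
move=> [sa pa] at_; set b := _ - a.
have t0 : 0 <= t := le_trans (rnorm_ge0 a) at_.
have [->|/eqP b0] := eqVneq b 0; first by rewrite rnorm0.
have sb : star b = b by rewrite starB star_scale1 conjC_real_complex sa.
rewrite leNgt; apply/negP => tb.
have [] := cstar_spectrum_rnorm sb b0 => /cstar_spectrum_shift.
  by rewrite -rmorphB /= => /pa; rewrite ler0c; lra.
rewrite -rmorphB /= opprK => /cstar_spectrum_norm.
rewrite normc_def /= expr0n addr0 sqrtr_sqr ger0_norm ?addr_ge0 ?rnorm_ge0//.
by lra.
Qed.

(** The spectrum of [t - a] lies in [[-t, t]], so [t - z <= t] for [z] in the spectrum of [a]. *)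
Lemma positive_rnorm_shift a t : star a = a ->
  rnorm (t%:C *: (1 : A) - a) <= t -> cstar_positive a.
Proof.
move=> sa at_; split=> // z sz; have zE := cstar_spectrum_selfadjoint sa sz.
rewrite zE ler0c.
have : cstar_spectrum (t%:C *: (1 : A) - a) (t%:C - z).
  by apply/cstar_spectrum_shift; rewrite opprB addrC subrK.
move/cstar_spectrum_norm => /le_trans/(_ at_).
rewrite {1}zE -rmorphB normc_def /= expr0n addr0 sqrtr_sqr ler_norml.
by lra.
Qed.

(** In terms of the norm criterion this is the triangle inequality, at [t = |a| + |b|]. *)
Lemma cstar_positiveD a b :
  cstar_positive a -> cstar_positive b -> cstar_positive (a + b).
Proof.
move=> pa pb; apply: (@positive_rnorm_shift _ (rnorm a + rnorm b)).
  by rewrite starD pa.1 pb.1.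
rewrite rmorphD scalerDl opprD addrACA (le_trans (ler_rnormD _ _))//.
by rewrite lerD// rnorm_shift_positive.
Qed.

Lemma cstar_positive0 : cstar_positive (0 : A).
Proof.
apply: (@positive_rnorm_shift _ 0); first exact: star0.
by rewrite rmorph0 scale0r subr0 rnorm0.
Qed.

Lemma cstar_positive_sum (I : Type) (r : seq I) (P : pred I) (F : I -> A) :
  (forall i, P i -> cstar_positive (F i)) ->
  cstar_positive (\sum_(i <- r | P i) F i).
Proof.
by move=> FP; elim/big_ind: _ => //;
  [exact: cstar_positive0 | exact: cstar_positiveD].
Qed.

Lemma cstar_positiveZ a t : 0 <= t -> cstar_positive a ->
  cstar_positive (t%:C *: a).
Proof.
move=> t0 pa; apply: (@positive_rnorm_shift _ (t * rnorm a)).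
  by rewrite starZr pa.1.
rewrite rmorphM -scalerA -scalerBr rnormZr ger0_norm// ler_wpM2l//.
exact: rnorm_shift_positive.
Qed.

(** The norm criterion passes to limits at the fixed [t = |l| + 1], which eventually bounds
    [|u n|]. *)
Lemma cstar_positive_cvg (u : nat -> A) (l : A) :
  (exists N, forall n, (N <= n)%N -> cstar_positive (u n)) ->
  u @ \oo --> l -> cstar_positive l.
Proof.
move=> [N pu] ul; have /cvg_rnormP/(_ 1 ltr01)[N1 uN1] := ul.
apply: (@positive_rnorm_shift _ (rnorm l + 1)).
  apply: (@cstar_cvg_unique _ _ u) => //.
  apply/cvg_rnormP => e e0.
  have /cvg_star/cvg_rnormP/(_ e e0)[N2 uN2] := ul.
  exists (maxn N N2) => n; rewrite geq_max => /andP[/pu pn /uN2].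
  by rewrite pn.1.
apply: (@rnorm_le_cvg _ _ (fun n => (rnorm l + 1)%:C *: (1 : A) - u n)).
  by apply: cvgB => //; exact: cvg_cst.
exists (maxn N N1) => n; rewrite geq_max => /andP[/pu pn /uN1 ln].
apply: rnorm_shift_positive => //.
have := ler_rnormB l (l - u n); rewrite opprB addrC subrK => /le_trans; apply.
by rewrite lerD2l ltW.
Qed.

(** With [t = |b|], both [t - b] and its sum with [b - a] are positive, so the spectrum of [a] is at
    most [t]; it contains [|a|] or [-|a|]. *)
Lemma ler_rnorm_positive a b :
  cstar_positive a -> cstar_positive (b - a) -> rnorm a <= rnorm b.
Proof.
move=> pa pba; have pb : cstar_positive b.
  by rewrite -(subrK a b); exact: cstar_positiveD.
set t := rnorm b; have ptb : cstar_positive (t%:C *: (1 : A) - b).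
  apply: (@positive_rnorm_shift _ t).
    by rewrite starB star_scale1 conjC_real_complex pb.1.
  by rewrite opprB addrC subrK.
have pta : cstar_positive (t%:C *: (1 : A) - a).
  by rewrite -(subrKA b); exact: cstar_positiveD.
have [->|/eqP a0] := eqVneq a 0; first by rewrite rnorm0 rnorm_ge0.
have [ra|] := cstar_spectrum_rnorm pa.1 a0.
  have /pta.2 : cstar_spectrum (t%:C *: (1 : A) - a) (t - rnorm a)%:C.
    by apply/cstar_spectrum_shift; rewrite rmorphB opprB addrC subrK.
  by rewrite ler0c subr_ge0.
move/pa.2; rewrite ler0c oppr_ge0 => /le_trans; apply.
exact: rnorm_ge0.
Qed.

Lemma cstar_invertible_nonreal z a : star a = a -> complex.Im z != 0 ->
  cstar_invertible (z *: (1 : A) + a).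
Proof.
move=> sa /eqP z0; apply: contrapT => iz; apply: z0.
suff -> : z = (complex.Re z)%:C by [].
apply: (@cstar_spectrum_selfadjoint _ _ (- a)); first by rewrite starN sa.
by rewrite /cstar_spectrum /= opprK.
Qed.

(** A negative number is [-t^2], and [t^2 + a^2 = (a - i t) (a + i t)] is invertible. *)
Lemma cstar_positive_sqr a : star a = a -> cstar_positive (a * a).
Proof.
move=> sa; have saa : star (a * a) = a * a by rewrite star_mul sa.
split=> // z sz; have zE := cstar_spectrum_selfadjoint saa sz.
rewrite zE ler0c leNgt; apply/negP => z0; apply: sz.
rewrite zE -[complex.Re z]opprK -(@sqr_sqrtr _ (- complex.Re z)) ?oppr_ge0
  ?ltW//.
set t := Num.sqrt _; have t0 : t != 0 by rewrite sqrtr_eq0 -ltNge oppr_gt0.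
apply/cstar_invertibleN; rewrite opprB addrC rmorphN scaleNr opprK.
rewrite -mul_imag_shifts; apply: cstar_invertibleM;
  apply: cstar_invertible_nonreal => //=.
  by rewrite !(mul0r, mul1r, mulr0, add0r, addr0) oppr_eq0.
by rewrite !(mul0r, mul1r, mulr0, add0r, addr0).
Qed.

(** If [c] inverts [z - y x], then [z^-1 (1 + x c y)] inverts [z - x y]. *)
Lemma cstar_spectrum_mulC x y z : z != 0 ->
  cstar_spectrum (x * y) z -> cstar_spectrum (y * x) z.
Proof.
move=> z0 sxy [c [h1 h2]]; apply: sxy.
have zVz : z^-1 * z = 1 by rewrite mulVf.
have e1 : (z *: (1 : A) - x * y) * (z^-1 *: (1 + x * c * y)) = 1.
  rewrite -cscalerAr mulrBl -cscalerAl mul1r.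
  have -> : x * y * (1 + x * c * y) = z *: (x * c * y).
    rewrite mulrDr mulr1 !mulrA -(mulrA x y x) -(mulrA x (y * x)).
    have -> : (y * x) * c = z *: c - 1.
      by rewrite -h1 mulrBl -cscalerAl mul1r opprB addrC subrK.
    by rewrite mulrBr mulr1 mulrBl cscalerAl cscalerAr addrC subrK.
  by rewrite -scalerBr addrK scalerA zVz scale1r.
have e2 : (z^-1 *: (1 + x * c * y)) * (z *: (1 : A) - x * y) = 1.
  rewrite -cscalerAl mulrBr -cscalerAr mulr1.
  have -> : (1 + x * c * y) * (x * y) = z *: (x * c * y).
    rewrite mulrDl mul1r !mulrA -(mulrA (x * c) y x) -(mulrA x c).
    have -> : c * (y * x) = z *: c - 1.
      by rewrite -h2 mulrBr -cscalerAr mulr1 opprB addrC subrK.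
    by rewrite mulrBr mulr1 mulrBl -cscalerAr -cscalerAl addrC subrK.
  by rewrite -scalerBr addrK scalerA zVz scale1r.
by exists (z^-1 *: (1 + x * c * y)).
Qed.

(* If [-1] is in the spectrum of [h = x x^*], replace [x] by
   [y = (1 + i + h)^-1 x].  As [t / |1 + i + t|^2] is less than [1/4] for
   [t >= 0] and is [-1] at [t = -1], the spectrum of [y y^*], hence that of
   [y^* y], lies below [1/4] while [-1] is in the spectrum of [y y^*]. This
   contradicts the positivity of [y y^* + y^* y]. *)
Lemma cstar_invertible_1D_mul_star x : cstar_invertible (1 + x * star x).
Proof.
set h := x * star x; have sh : star h = h by rewrite star_mul starK.
set g := (1 + 'i) *: (1 : A) + h.
have sg : star g = (1 - 'i) *: (1 : A) + h.
  by rewrite starD star_scale1 rmorphD rmorph1 /= conjCi sh.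
have [c [gc cg]] : cstar_invertible g.
  by apply: cstar_invertible_nonreal => //=; rewrite add0r oner_eq0.
have gg : g * star g = (2 : R[i]) *: (1 : A) + ((2 : R[i]) *: h + h * h).
  rewrite sg mul_shifts [RHS]addrA; congr (_ *: _ + _ *: _ + _).
    by rewrite mulrC -subr_sqr expr1n sqrCi opprK.
  by rewrite addrACA subrr addr0.
have scsg : star g * star c = 1 by rewrite -star_mul cg star1.
have sgsc : star c * star g = 1 by rewrite -star_mul gc star1.
have ic : cstar_invertible c by exists g.
have isc : cstar_invertible (star c) by exists (star g).
pose y := c * x; have yy : y * star y = c * h * star c.
  by rewrite star_mul /h !mulrA.
(* The invertible outer factors reduce the spectrum of [y y^*] to quadratic polynomials in [h]. *)
have resolv (m : R[i]) :
    m *: (1 : A) - y * star y = c * (m *: (g * star g) - h) * star c.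
  rewrite mulrBr mulrBl yy -cscalerAr -cscalerAl; congr (_ *: _ - _).
  by rewrite mulrA cg mul1r scsg.
have spec_lt (m : R) : 4^-1 <= m -> ~ cstar_spectrum (y * star y) m%:C.
  move=> m4; apply; rewrite resolv; apply: cstar_invertibleM => //.
  apply: cstar_invertibleM => //.
  have m0 : 0 < m by apply: lt_le_trans m4; rewrite invr_gt0.
  have mn0 : m != 0 by rewrite gt_eqF.
  (* The quadratic is [m (h^2 + (2 - 1/m) h + 2)], with roots [-u + i v] and [-u - i v] where
     [u^2 + v^2 = 2]. From [m >= 1/4] follows [u^2 <= 1], so the roots are not real. *)
  pose u := 1 - (2 * m)^-1.
  have u2 : u ^+ 2 <= 1.
    rewrite /u invfM; have : 0 < m^-1 <= 4.
      by rewrite invr_gt0 m0 /= -[4]invrK lef_pV2 ?posrE ?invr_gt0.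
    by move: (m^-1) => v; nra.
  pose v := Num.sqrt (2 - u ^+ 2).
  have v0 : v != 0 by rewrite sqrtr_eq0 -ltNge; lra.
  have vv : v ^+ 2 = 2 - u ^+ 2 by rewrite sqr_sqrtr//; lra.
  have -> : m%:C *: (g * star g) - h =
      m%:C *: (((u +i* v) *: (1 : A) + h) * ((u +i* (- v)) *: (1 : A) + h)).
    have zz : (u +i* v) * (u +i* (- v)) = 2.
      apply/eqP;
        rewrite eq_complex /= mulrN opprK -!expr2 vv addrC subrK eqxx /=.
      by rewrite mulrN mulrC addNr addr0.
    have zs : m%:C * ((u +i* v) + (u +i* (- v))) = m%:C * 2 - 1.
      apply/eqP;
        rewrite eq_complex /= subrr !(mul0r, mulr0, subr0, addr0) eqxx andbT.
      by rewrite /u; apply/eqP; field.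
    rewrite gg mul_shifts zz -[in RHS]addrA !scalerDr -addrA; congr (_ + _).
    by rewrite !scalerA zs scalerBl scale1r addrAC.
  apply: cstar_invertibleZ; first by rewrite fmorph_eq0.
  by apply: cstar_invertibleM; apply: cstar_invertible_nonreal;
    rewrite //= oppr_eq0.
have psy : cstar_positive ((4^-1 : R)%:C *: (1 : A) - star y * y).
  have sa : star (star y * y) = star y * y by rewrite star_mul starK.
  split;
    first by rewrite /cstar_selfadjoint starB star_scale1 conjC_real_complex sa.
  move=> z /cstar_spectrum_shift sz.
  have zE := cstar_spectrum_selfadjoint sa sz.
  (* Exchanging [y^* y] for [y y^*] preserves only nonzero spectral values. *)
  have [z0|z0] := eqVneq ((4^-1)%:C - z) 0.
    by rewrite -(subKr (4^-1)%:C z) z0 subr0 ler0c invr_ge0.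
  have := cstar_spectrum_mulC z0 sz; rewrite zE => sz'.
  have : complex.Re ((4^-1)%:C - z) < 4^-1.
    by rewrite ltNge; apply/negP => /spec_lt.
  move=> lt4; rewrite -(subKr (4^-1)%:C z) zE -rmorphB ler0c subr_ge0.
  exact: ltW.
(* Up to sign, [P] and [Q] are twice the real and imaginary parts of [y]. *)
set P := y + star y; set Q := 'i *: (y - star y).
have sP : star P = P by rewrite starD starK addrC.
have sQ : star Q = Q by rewrite starZi starB starK -scalerN opprB.
have PQ : P * P + Q * Q = (2 : R)%:C *: (y * star y + star y * y).
  have ii : 'i * 'i = -1 :> R[i] by rewrite -expr2 sqrCi.
  rewrite /Q -cscalerAl -cscalerAr scalerA ii scaleN1r.
  have -> : (y - star y) * (y - star y) =
      y * y - y * star y - (star y * y - star y * star y) by rewrite mulrBl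
        !mulrBr.
  rewrite mulrDl !mulrDr !opprB.
  rewrite (AC ((2*2)*(2*2)) (((2*3)*(7*5))*(1*8)*(4*6))) /= !subrr !addr0.
  by rewrite rmorph_nat scaler_nat mulr2n.
have pw : cstar_positive ((4^-1 : R)%:C *: (1 : A) + y * star y).
  have -> : (4^-1 : R)%:C *: (1 : A) + y * star y =
      (2^-1 : R)%:C *: (P * P + Q * Q) + ((4^-1 : R)%:C *: (1 : A) - star y *
        y).
    by rewrite PQ scalerA -rmorphM mulVf// rmorph1 scale1r addrACA subrr addr0
      addrC.
  apply: cstar_positiveD => //; apply: cstar_positiveZ;
    first by rewrite invr_ge0.
  by apply: cstar_positiveD; exact: cstar_positive_sqr.
have : cstar_invertible ((-1) *: (1 : A) - y * star y).
  apply: contrapT => i1.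
  have /pw.2 : cstar_spectrum ((4^-1 : R)%:C *: (1 : A) + y * star y) (4^-1 -
    1)%:C.
    rewrite -[X in _ + X]opprK; apply/cstar_spectrum_shift.
    rewrite rmorphB rmorph1 opprB addrC subrK => i1'; apply: i1.
    rewrite scaleN1r -opprD; apply/cstar_invertibleN.
    by move: i1'; rewrite opprK scale1r.
  by rewrite ler0c; lra.
rewrite resolv => i2.
have i3 : cstar_invertible (-1 *: (g * star g) - h).
  have ig : cstar_invertible g by exists c.
  have isg : cstar_invertible (star g) by exists (star c).
  have := cstar_invertibleM (cstar_invertibleM ig i2) isg.
  by rewrite -!mulrA sgsc mulr1 mulrA gc mul1r.
(* [g g^* + h = 2 + 3 h + h^2 = (1 + h) (2 + h)], with commuting factors. *)
apply: (@cstar_invertible_comm _ _ _ ((2 : R[i]) *: (1 : A) + h)).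
  apply: commrD; last by apply/commr_sym/commrD;
    [exact: commr1|exact: commr_refl].
  by rewrite /GRing.comm -cscalerAr -cscalerAl mul1r mulr1.
rewrite -[X in X + h]scale1r mul_shifts mul1r.
have -> : (2 : R[i]) *: (1 : A) + (1 + 2 : R[i]) *: h + h * h = - (-1 *: (g *
  star g) - h).
  rewrite scaleN1r -opprD opprK gg scalerDl scale1r -!addrA; congr (_ + _).
  by rewrite [LHS]addrC -addrA.
exact/cstar_invertibleN.
Qed.

(** Scaling [x] by [(- r)^(-1/2)] moves a negative spectral value [r] to [-1], which is excluded. *)
Lemma cstar_positive_mul_star x : cstar_positive (x * star x).
Proof.
have sh : star (x * star x) = x * star x by rewrite star_mul starK.
split=> // z sz; have zE := cstar_spectrum_selfadjoint sh sz.
rewrite zE ler0c leNgt; apply/negP => z0; apply: sz.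
set r := complex.Re z in z0 zE; pose t := Num.sqrt (- r)^-1.
have t0 : 0 < t by rewrite sqrtr_gt0 invr_gt0 oppr_gt0.
have tt : t * t * r = -1.
  by rewrite -expr2 sqr_sqrtr ?invr_ge0 ?oppr_ge0 ?ltW// invrN mulNr mulVf//
    lt_eqF.
have := cstar_invertible_1D_mul_star (t%:C *: x).
rewrite starZr -cscalerAl -cscalerAr scalerA => i1.
apply/(@cstar_invertibleZE _ _ (- (t * t))%:C).
  by rewrite fmorph_eq0 oppr_eq0 mulf_neq0 ?gt_eqF.
rewrite zE scalerBr scalerA -rmorphM mulNr tt opprK rmorph1 scale1r.
by rewrite rmorphN scaleNr opprK rmorphM.
Qed.

End PositiveCone.

(** * Continuity of the inner product *)

Section HilbertModules.
Context {R : realType} {A : unitalCStarAlgType R} {H : hilbertModType A}.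
Implicit Types (x y z : H) (a : A) (c : R[i]).

Lemma inner_sum_l (I : Type) (r : seq I) (P : pred I) (F : I -> H) y :
  inner (\sum_(i <- r | P i) F i) y = \sum_(i <- r | P i) inner (F i) y.
Proof.
have i0 : inner 0 y = 0 by apply: (addIr (inner 0 y)); rewrite -innerDl !add0r.
by elim/big_rec2: _ => [//|i u v _ <-]; rewrite innerDl.
Qed.

Lemma innerZ_l c x y : inner (c *: x) y = c *: inner x y.
Proof. by rewrite -[x in LHS]act1 -actZl inner_actl -cscalerAl mul1r. Qed.

Lemma innerN_l x y : inner (- x) y = - inner x y.
Proof. by rewrite -scaleN1r innerZ_l scaleN1r. Qed.

Lemma innerB_l x y z : inner (x - y) z = inner x z - inner y z.
Proof. by rewrite innerDl innerN_l. Qed.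

Lemma innerD_r x y z : inner x (y + z) = inner x y + inner x z.
Proof. by rewrite inner_star innerDl starD -!inner_star. Qed.

Lemma innerZ_r c x y : inner x (c *: y) = Num.conj c *: inner x y.
Proof. by rewrite inner_star innerZ_l starZ -inner_star. Qed.

Lemma innerN_r x y : inner x (- y) = - inner x y.
Proof. by rewrite inner_star innerN_l starN -inner_star. Qed.

Lemma innerB_r x y z : inner x (y - z) = inner x y - inner x z.
Proof. by rewrite innerD_r innerN_r. Qed.

Lemma star_inner x y : star (inner x y) = inner y x.
Proof. by rewrite -inner_star. Qed.

Lemma inner_positive x : cstar_positive (inner x x).
Proof. by have [_ _] := inner_pos x; rewrite subr0. Qed.

Lemma rnorm_inner_diag x : rnorm (inner x x) = rnorm x ^+ 2.
Proof.
have := inner_norm x; rewrite !normE -rmorphXn /= => /eqP.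
by rewrite eq_complex /= eqxx andbT => /eqP.
Qed.

Lemma rnorm_inner_real_part x y :
  rnorm (inner x y + inner y x) <= 2 * (rnorm x + rnorm y) ^+ 2.
Proof.
have -> : inner x y + inner y x = inner (x + y) (x + y) - inner x x - inner y y.
  rewrite innerDl !innerD_r.
  by rewrite (AC (2*2*1*1) ((2*3)*(1*5)*(4*6))) /= !subrr !addr0.
have h1 := ler_rnormB (inner (x + y) (x + y) - inner x x) (inner y y).
have h2 := ler_rnormB (inner (x + y) (x + y)) (inner x x).
rewrite !rnorm_inner_diag in h1 h2.
have h3 : rnorm (x + y) ^+ 2 <= (rnorm x + rnorm y) ^+ 2.
  by rewrite lerXn2r ?nnegrE ?addr_ge0 ?rnorm_ge0// ler_rnormD.
have x0 := rnorm_ge0 x; have y0 := rnorm_ge0 y.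
apply: (le_trans h1); nra.
Qed.

(** [2 <x, y>] is a combination of the symmetric sums for [(x, y)] and [(x, i y)], each bounded by
    polarization. *)
Lemma rnorm_inner_sum x y : rnorm (inner x y) <= 2 * (rnorm x + rnorm y) ^+ 2.
Proof.
have e : (2 : R)%:C *: inner x y =
    (inner x y + inner y x) + 'i *: (inner x ('i *: y) + inner ('i *: y) x).
  rewrite innerZ_l innerZ_r conjCi scaleNr scalerDr scalerN !scalerA.
  have -> : 'i * 'i = -1 :> R[i] by rewrite -expr2 sqrCi.
  by rewrite !scaleN1r opprK addrACA subrr addr0 rmorph_nat scaler_nat mulr2n.
have ni : rnorm ('i *: y) = rnorm y by rewrite rnormZ normCi mul1r.
have h1 := rnorm_inner_real_part x y.
have h2 := rnorm_inner_real_part x ('i *: y); rewrite ni in h2.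
have := ler_rnormD (inner x y + inner y x) ('i *: (inner x ('i *: y) + inner
  ('i *: y) x)).
rewrite -e rnormZr normr_nat rnormZ normCi mul1r; lra.
Qed.

(** Cauchy-Schwarz up to a constant: for unit vectors the previous bound is [2 (1 + 1)^2 = 8]. *)
Lemma rnorm_inner x y : rnorm (inner x y) <= 8 * (rnorm x * rnorm y).
Proof.
have [x0|x0] := eqVneq (rnorm x) 0.
  by rewrite (rnorm_eq0 x0) -[0 : H](scale0r x) innerZ_l !scale0r !rnorm0 mul0r
    mulr0.
have [y0|y0] := eqVneq (rnorm y) 0.
  by rewrite (rnorm_eq0 y0) -[0 : H](scale0r x) innerZ_r rmorph0 !scale0r
    !rnorm0 !mulr0.
have unit (v : H) : rnorm v != 0 -> rnorm ((rnorm v)^-1%:C *: v) = 1.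
  by move=> v0; rewrite rnormZr ger0_norm ?invr_ge0 ?rnorm_ge0// mulVf.
have := rnorm_inner_sum ((rnorm x)^-1%:C *: x) ((rnorm y)^-1%:C *: y).
rewrite !unit// innerZ_l innerZ_r conjC_real_complex scalerA -rmorphM rnormZr.
rewrite ger0_norm ?mulr_ge0 ?invr_ge0 ?rnorm_ge0// -invfM mulrC.
rewrite ler_pdivrMr ?mulr_gt0 ?lt0r ?x0 ?y0 ?rnorm_ge0//.
by move=> /le_trans; apply; rewrite le_eqVlt; apply/orP; left; apply/eqP; ring.
Qed.

Lemma cvg_inner_l (u : nat -> H) (l y : H) :
  u @ \oo --> l -> (fun n => inner (u n) y) @ \oo --> inner l y.
Proof.
move=> /cvg_rnormP ul; apply/cvg_rnormP => e e0.
have c0 : 0 < 8 * (rnorm y + 1) by rewrite mulr_gt0// ltr_wpDl// rnorm_ge0.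
have [N uN] := ul _ (divr_gt0 e0 c0); exists N => n /uN.
rewrite ltr_pdivlMr// => h.
rewrite -innerB_l (le_lt_trans (rnorm_inner _ _))// (le_lt_trans _ h)//.
by have := rnorm_ge0 (l - u n); nra.
Qed.

End HilbertModules.

(** * The frame operator of a Bessel sequence *)

Section BesselSequences.
Context {R : realType} {A : unitalCStarAlgType R} {H : hilbertModType A}.
Context (fk : nat -> H) (eta : R) (fk_bessel : bessel_bound fk eta).
Implicit Types (f g h : H).

Let eta_gt0 : 0 < eta. Proof. by case: fk_bessel. Qed.

Lemma cvg_frame_series f : frame_series fk f @ \oo --> limn (frame_series fk f).
Proof. by case: fk_bessel => _ /(_ f)[]. Qed.

Lemma frame_block_positive f m n :
  cstar_positive (\sum_(m <= k < n) inner f (fk k) * inner (fk k) f).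
Proof.
apply: cstar_positive_sum => k _; rewrite -(star_inner f).
exact: cstar_positive_mul_star.
Qed.

(** The difference splits into the Bessel gap at the limit, the tail after [n] and the partial sum
    before [m], all positive. *)
Lemma bessel_block f m n : (m <= n)%N ->
  cstar_positive (eta%:C *: inner f f -
                  \sum_(m <= k < n) inner f (fk k) * inner (fk k) f).
Proof.
move=> mn; have [_ /(_ f)[_ [_ _ le_eta]]] := fk_bessel.
set F := fun k => inner f (fk k) * inner (fk k) f.
rewrite -(subrKA (limn (frame_series fk f))); apply: cstar_positiveD => //.
rewrite -(subrKA (frame_series fk f n)); apply: cstar_positiveD.
  apply: (@cstar_positive_cvg _ _ (fun N => frame_series fk f N - frame_series
    fk f n)).
    exists n => N nN; rewrite /frame_series sub_series_geq//.
    exact: frame_block_positive.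
  by apply: cvgB; [exact: cvg_frame_series | exact: cvg_cst].
rewrite -(sub_series_geq F mn) opprB addrC subrK /series /=.
exact: frame_block_positive.
Qed.

(* With [h] the sum on the left, [a k = <f, f_k>] and [b k = <h, f_k>], the
  Bessel bound for [h] and
   [0 <= \sum (eta a k - b k) (eta a k - b k)^*] give the inequality, because
   [\sum a k (b k)^* = <h, h>]. *)
Lemma bessel_synthesis_block f m n : (m <= n)%N ->
  rnorm (\sum_(m <= k < n) act (inner f (fk k)) (fk k)) ^+ 2 <=
  eta * rnorm (\sum_(m <= k < n) inner f (fk k) * inner (fk k) f).
Proof.
move=> mn; set h := \sum_(m <= k < n) act _ _;
  set P := \sum_(m <= k < n) inner f (fk k) * inner (fk k) f.
have hh1 : inner h h = \sum_(m <= k < n) inner f (fk k) * inner (fk k) h.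
  by rewrite {1}/h inner_sum_l; apply: eq_bigr => k _; rewrite inner_actl.
have hh2 : inner h h = \sum_(m <= k < n) inner h (fk k) * inner (fk k) f.
  rewrite -star_inner hh1 (big_morph star (@starD R A) star0).
  by apply: eq_bigr => k _; rewrite star_mul !star_inner.
set Q := \sum_(m <= k < n) inner h (fk k) * inner (fk k) h.
have pQ : cstar_positive (eta%:C *: inner h h - Q) by exact: bessel_block.
pose v k := eta%:C *: inner f (fk k) - inner h (fk k).
have vE : \sum_(m <= k < n) v k * star (v k) =
    eta%:C *: (eta%:C *: P - inner h h) - (eta%:C *: inner h h - Q).
  rewrite [X in X - (_ - Q)](_ : _ = eta%:C *: (eta%:C *: P -
    \sum_(m <= k < n) inner h (fk k) * inner (fk k) f)); last by rewrite -hh2.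
  rewrite hh1 scalerBr scalerA !scaler_sumr /Q -!sumrB.
  apply: eq_bigr => k _; rewrite /v starB starZr !star_inner.
  rewrite mulrBl !mulrBr -!cscalerAr -!cscalerAl !scalerA.
  by rewrite !opprB addrACA [in RHS]addrACA [X in _ = _ + X]addrC.
have pE : cstar_positive (eta%:C *: P - inner h h).
  rewrite -[X in cstar_positive X]scale1r -[1](_ : eta^-1%:C * eta%:C = 1).
    rewrite -scalerA; apply: cstar_positiveZ; first by rewrite invr_ge0 ltW.
    rewrite -[X in cstar_positive X](subrK (eta%:C *: inner h h - Q)) -vE.
    apply: cstar_positiveD => //; apply: cstar_positive_sum => k _.
    exact: cstar_positive_mul_star.
  by rewrite -rmorphM mulVf// gt_eqF.
rewrite -rnorm_inner_diag (le_trans (ler_rnorm_positive (inner_positive h)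
  pE))//.
by rewrite rnormZr ger0_norm// ltW.
Qed.

(** [frame_operator] is defined through [limn]; convergence is what makes it the sum of its
    series. *)
Lemma cvg_frame_operator f :
  series (fun k => act (inner f (fk k)) (fk k)) @ \oo --> frame_operator fk f.
Proof.
suff : cvgn (series (fun k => act (inner f (fk k)) (fk k))) by [].
apply: cauchy_rnorm => e e0.
(* A block is a difference of two distances to the limit, each below half of [e^2 / eta]; the factor
   [eta] comes from the block estimate. *)
have e1 : 0 < e ^+ 2 / eta / 2 by rewrite !divr_gt0 ?exprn_gt0.
have /cvg_rnormP/(_ _ e1)[N sN] := @cvg_frame_series f.
exists N => n Nn; rewrite rnormB sub_series_geq//.
rewrite -(@ltr_pXn2r _ 2) ?nnegrE ?rnorm_ge0 ?ltW//.
rewrite (le_lt_trans (bessel_synthesis_block f Nn))//.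
rewrite mulrC -ltr_pdivlMr//.
have -> : \sum_(N <= k < n) inner f (fk k) * inner (fk k) f =
    (limn (frame_series fk f) - frame_series fk f N) -
    (limn (frame_series fk f) - frame_series fk f n).
  by rewrite opprB addrC subrKA /frame_series sub_series_geq.
rewrite (le_lt_trans (ler_rnormB _ _))//.
by rewrite [ltRHS]splitr ltrD// sN.
Qed.

(** Each partial sum has squared norm at most [eta] times that of a block, itself at most
    [eta |f|^2]. *)
Lemma rnorm_frame_operator f : rnorm (frame_operator fk f) <= eta * rnorm f.
Proof.
apply: rnorm_le_cvg (@cvg_frame_operator f) _; exists 0%N => n _.
rewrite -(@ler_pXn2r _ 2) ?nnegrE ?mulr_ge0 ?rnorm_ge0 ?(ltW eta_gt0)//.
rewrite (le_trans (bessel_synthesis_block f (leq0n n)))//.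
have := ler_rnorm_positive (frame_block_positive f 0 n) (bessel_block f (leq0n
  n)).
rewrite rnormZr rnorm_inner_diag gtr0_norm// => le_eta.
by rewrite exprMn expr2 -mulrA ler_pM2l.
Qed.

Lemma cvg_inner_frame_operator f g :
  series (fun k => inner f (fk k) * inner (fk k) g) @ \oo -->
  inner (frame_operator fk f) g.
Proof.
have := @cvg_inner_l _ _ _ _ _ g (@cvg_frame_operator f).
apply: cvg_trans; apply: near_eq_cvg; near=> n.
by rewrite /series /= inner_sum_l; apply: eq_bigr => k _; rewrite inner_actl.
Unshelve. all: by end_near. Qed.

(** [<S f, g>] and [<S g, f>^*] are limits of the same series. *)
Lemma frame_operator_self_adjoint : self_adjoint (frame_operator fk).
Proof.
move=> f g; rewrite -[RHS]star_inner.
apply: (cstar_cvg_unique (@cvg_inner_frame_operator f g)).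
have := cvg_star (@cvg_inner_frame_operator g f).
apply: cvg_trans; apply: near_eq_cvg; near=> n.
rewrite /series /= (big_morph star (@starD R A) star0).
by apply: eq_bigr => k _; rewrite star_mul !star_inner.
Unshelve. all: by end_near. Qed.

Lemma limn_frame_series f :
  limn (frame_series fk f) = inner (frame_operator fk f) f.
Proof.
exact: cstar_cvg_unique (@cvg_frame_series f) (@cvg_inner_frame_operator f f).
Qed.

End BesselSequences.

Theorem proposition2p1 (R : realType) (A : unitalCStarAlgType R)
    (H : hilbertModType A) (Hcg : countably_generated H)
    (fk : nat -> H) (eta : R) (Hbessel : bessel_bound fk eta)
    (T : {linear H -> H}) (xi : R)
    (HS : forall f : H, frame_operator fk f = T f + xi%:C *: f) :
  [/\ positive_operator T -> 0 < xi -> is_frame fk,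
      bounded_operator T /\ self_adjoint T &
      forall a : R, 0 < a -> frame_lower_bound fk a -> xi <= a ->
        positive_operator T].
Proof.
have TE f : T f = frame_operator fk f - xi%:C *: f by rewrite HS addrK.
have innerT f : inner (T f) f = limn (frame_series fk f) - xi%:C *: inner f f.
  by rewrite (limn_frame_series Hbessel) TE innerB_l innerZ_l.
have sT : self_adjoint T.
  move=> f g;
    rewrite !TE innerB_l innerB_r innerZ_l innerZ_r conjC_real_complex.
  by rewrite (frame_operator_self_adjoint Hbessel).
have sZ (r : R) f : cstar_selfadjoint (r%:C *: inner f f).
  by rewrite /cstar_selfadjoint starZr star_inner.
split.
(* The lower bound is [xi]: the frame sum minus [xi <f, f>] is [<T f, f>]. *)
- move=> pT xi0; exists xi, eta; split=> //; first by case: Hbessel.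
  move=> f; have [_ /(_ f)[cf le_eta]] := Hbessel; split=> //.
  split=> //; first by case: le_eta.
  by rewrite -innerT; have [_ _] := pT f; rewrite subr0.
- split=> //; exists (eta + `|xi|) => f.
  rewrite !normE -rmorphM lecR TE (le_trans (ler_rnormB _ _))//.
  by rewrite rnormZr mulrDl lerD2r; exact: rnorm_frame_operator.
- move=> a a0 [b [_ _ frame_ab]] xia f; have [_ [_ _ le_a] _] := frame_ab f.
  split.
  + exact: star0.
  + by rewrite /cstar_selfadjoint star_inner sT.
  (* Insert [a <f, f>]: the frame inequality gives one positive term, and [(a - xi) <f, f>] is the
     other. *)
  rewrite subr0 innerT -(subrKA (a%:C *: inner f f));
    apply: cstar_positiveD => //.
  rewrite -scalerBl -rmorphB; apply: cstar_positiveZ; first by rewrite subr_ge0.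
  exact: inner_positive.
Qed.
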